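(* Let $\mathbb{F}\in\{\mathbb{R},\mathbb{C}\}$, let $A$ be an $n\times m$ matrix over $\mathbb{F}$, and let $p\in[1,\infty)$, $q\in(1,\infty]$. Then $A\in\mathcal{E}_{\infty,1}(p,q)$ if and only if there is a vector $v\in\mathbb{F}^m$ such that (i) $v$ is an eigenvector of $A^*A$; (ii) all entries of $v$ have absolute value $1$; (iii) all entries of $Av$ have the same absolute value $\tau$; and (iv) $\tau=m^{1/p}n^{-1/q}\|A\|_{p,q}$. In particular, $A\in\mathcal{E}_{\infty,1}(2,2)$ if and only if $A^*A$ has an eigenvector $v$ with properties (ii) and (iii) which corresponds to its largest eigenvalue.
   Context: $\|x\|_p$ is the Hölder $\ell_p$ norm; $\|A\|_{p,q}=\max_{x\in\mathbb{F}^m,x\ne0}\|Ax\|_q/\|x\|_p$ (for real $A$ one may use $\mathbb{F}=\mathbb{R}$ or $\mathbb{C}$, all vectors being taken over the chosen field); $1/\infty=0$; $A^*$ is the conjugate transpose. For $p\in[1,\infty)$, $q\in(1,\infty]$, $\mathcal{E}_{\infty,1}(p,q)$ is the set of $n\times m$ matrices $A$ with $\|A\|_{r,s}=m^{(1/p)-(1/r)}n^{(1/s)-(1/q)}\|A\|_{p,q}$ for all $r\in(p,\infty]$ and $s\in[1,q)$. *)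

(* Defs.v *)
From HB Require Import structures.
From mathcomp Require Import all_boot all_order all_algebra.
From mathcomp Require Import classical_sets boolp reals constructive_ereal ereal.
From mathcomp Require Import exp.
From mathcomp Require Import complex.

Set Implicit Arguments.
Unset Strict Implicit.
Unset Printing Implicit Defensive.

Import Order.TTheory GRing.Theory Num.Theory.
Local Open Scope classical_set_scope.
Local Open Scope ring_scope.

(* Generic development over a scalar field F (to be instantiated with
   F = R or F = R[i]), given its modulus absF : F -> R and its conjugation
   conjF : F -> F.  Exponents live in the extended reals \bar R so that the
   exponent +oo (the sup norm) is allowed. *)
Section Norms.
Variables (R : realType) (F : numFieldType) (absF : F -> R) (conjF : F -> F).

Definition inv_exp (r : \bar R) : R :=
  match r with EFin x => x^-1 | _ => 0 end.

Definition lpnorm (r : \bar R) (k : nat) (x : 'cV[F]_k) : R :=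
  match r with
  | EFin p => (\sum_(i < k) (absF (x i 0)) `^ p) `^ p^-1
  | +oo%E => \big[Num.max/0]_(i < k) absF (x i 0)
  | -oo%E => 0
  end.

Definition opnorm (r s : \bar R) (n m : nat) (A : 'M[F]_(n, m)) : R :=
  sup [set lpnorm s (A *m x) / lpnorm r x | x in [set x : 'cV[F]_m | x != 0]].

Definition adjmx (n m : nat) (A : 'M[F]_(n, m)) : 'M[F]_(m, n) :=
  map_mx conjF A^T.

Definition eigenpair (k : nat) (M : 'M[F]_k) (v : 'cV[F]_k) (lam : F) :=
  v != 0 /\ M *m v = lam *: v.

Definition eigenvector (k : nat) (M : 'M[F]_k) (v : 'cV[F]_k) :=
  exists lam : F, eigenpair M v lam.

Definition E_inf1 (p : R) (q : \bar R) (n m : nat) (A : 'M[F]_(n, m)) :=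
  forall r s : \bar R, (p%:E < r)%E -> (1%:E <= s)%E -> (s < q)%E ->
    opnorm r s A =
      (m%:R `^ (p^-1 - inv_exp r)) * (n%:R `^ (inv_exp s - inv_exp q))
      * opnorm p%:E q A.

Definition theorem6_prop : Prop :=
  forall (n m : nat), (0 < n)%N -> (0 < m)%N ->
  forall A : 'M[F]_(n, m),
  (forall (p : R) (q : \bar R), 1 <= p -> (1%:E < q)%E ->
    E_inf1 p q A <->
    exists v : 'cV[F]_m,
      [/\ eigenvector (adjmx A *m A) v,
          (forall j, absF (v j 0) = 1) &
          exists tau : R,
            (forall i, absF ((A *m v) i 0) = tau) /\
            tau = m%:R `^ p^-1 * n%:R `^ (- inv_exp q) * opnorm p%:E q A])
  /\
  (E_inf1 2 2%:E A <->
    exists (v : 'cV[F]_m) (lam : F),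
      [/\ eigenpair (adjmx A *m A) v lam,
          (forall j, absF (v j 0) = 1),
          (exists tau : R, forall i, absF ((A *m v) i 0) = tau) &
          (forall (mu : F) (w : 'cV[F]_m),
             eigenpair (adjmx A *m A) w mu -> mu <= lam)]).

End Norms.

Definition theorem6_real (R : realType) : Prop :=
  @theorem6_prop R R (fun x : R => `|x|) (fun x : R => x).

Definition theorem6_complex (R : realType) : Prop :=
  @theorem6_prop R R[i] (@ComplexField.Normc.normc R) (@conjc R).

(* Main.v *)
Require Import Defs.
From mathcomp Require Import all_boot all_order all_algebra.
From mathcomp Require Import all_classical all_reals all_analysis.
From mathcomp Require Import complex ring lra.

Set Implicit Arguments.
Unset Strict Implicit.
Unset Printing Implicit Defensive.

Import Order.TTheory GRing.Theory Num.Theory.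
Import numFieldNormedType.Exports.
Local Open Scope ring_scope.

(** Since ||x||_p <= m^(1/p-1/r) ||x||_r and ||y||_s <= n^(1/s-1/q) ||y||_q, the
    norm ||A||_{r,s} never exceeds m^(1/p-1/r) n^(1/s-1/q) ||A||_{p,q}.  A flat v
    with A v flat of the prescribed modulus tau attains every one of these bounds.
    Conversely, a maximizer v of ||A x||_1 over ||x||_oo <= 1 turns the bound for
    (r, s) = (oo, 1) into a chain of equalities, and the equality cases make both v
    and A v flat.  The eigenvector property follows by duality: A^*A v is a
    functional of norm at most tau n^(1-1/q) ||A||_{p,q} on l_p which attains this
    norm at the flat vector v, hence it is proportional to v.  For p = q = 2,
    ||A||_{2,2}^2 is the largest eigenvalue of A^*A.

    Both scalar fields are treated at once, as a field F of the form R + R I with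
    I = 0 (F = R) or I = i (F = R[i]), where iota is the inclusion of R. *)

(** * Power mean inequality by tangent lines, with its equality case *)

Section PowerMeans.
Variable R : realType.
Implicit Types (p q x t : R) (r s : \bar R).

Lemma ln_lt_subr1 x : 0 < x -> x != 1 -> ln x < x - 1.
Proof.
move=> x0 x1; rewrite -ltr_expR lnK ?posrE//.
have := @expR_gt1Dx R (x - 1); rewrite subr_eq0 => /(_ x1).
by rewrite addrC subrK.
Qed.

Lemma ln_le_subr1 x : 0 < x -> ln x <= x - 1.
Proof.
have [->|x1] := eqVneq x 1; first by rewrite ln1 subrr.
by move=> x0; rewrite ltW// ln_lt_subr1.
Qed.

(* With y = 1 + q (t - 1), write ln y - q ln t = ln (y / t) + (q - 1) ln (1 / t)
   and bound both logarithms by ln z <= z - 1: the upper bounds add up to 0. *)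
Lemma powR_gt_tangent q t : 1 < q -> 0 <= t -> t != 1 ->
  1 + q * (t - 1) < t `^ q.
Proof.
move=> q1; rewrite le_eqVlt => /predU1P[<- _|t0 t1].
  by rewrite powR0 ?gt_eqF//; lra.
set y := 1 + _; have [y0|y0] := leP y 0.
  by rewrite (le_lt_trans y0)// powR_gt0.
rewrite -ltr_ln ?posrE ?powR_gt0// ln_powR.
have ty0 : 0 < y / t by rewrite divr_gt0.
have ti0 : 0 < t^-1 by rewrite invr_gt0.
have h1 := ln_le_subr1 ty0.
have h2 : ln t^-1 < t^-1 - 1 by apply: ln_lt_subr1; rewrite ?invr_eq1.
rewrite ln_div ?posrE// in h1.
rewrite lnV ?posrE// in h2.
have h3 : (q - 1) * - ln t < (q - 1) * (t^-1 - 1) by rewrite ltr_pM2l// subr_gt0.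
have h4 : y / t - 1 + (q - 1) * (t^-1 - 1) = 0.
  by rewrite /y; field; rewrite gt_eqF.
by lra.
Qed.

Lemma powR_ge_tangent q t : 1 < q -> 0 <= t -> 1 + q * (t - 1) <= t `^ q.
Proof.
move=> q1 t0; have [->|t1] := eqVneq t 1.
  by rewrite subrr mulr0 addr0 powR1.
by rewrite ltW// powR_gt_tangent.
Qed.

Section FixedSize.
Variable k : nat.
Hypothesis k0 : (0 < k)%N.
Implicit Types a y : 'I_k -> R.

Let kR0 : 0 < k%:R :> R. Proof. by rewrite ltr0n. Qed.

Let sum_gt0 y : (forall i, 0 <= y i) -> \sum_i y i != 0 -> 0 < \sum_i y i.
Proof. by move=> y0 S0; rewrite lt_def S0 sumr_ge0. Qed.

Let powR_mean_normalize q y : 0 < q -> (forall i, 0 <= y i) ->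
  0 < \sum_i y i ->
  \sum_i (y i / ((\sum_j y j) / k%:R)) `^ q =
  (k%:R `^ (q - 1) * \sum_i y i `^ q) / (\sum_i y i) `^ q * k%:R.
Proof.
move=> q0 y0; move: (\sum_i y i) => S S0.
rewrite mulr_sumr !mulr_suml; apply: eq_bigr => i _.
rewrite invf_div mulrA [_ * k%:R in LHS]mulrC -[_ / _ in LHS]mulrA.
rewrite powRM ?divr_ge0 ?ler0n ?(ltW S0)//.
rewrite [y i / _]mulrC powRM ?invr_ge0 ?(ltW S0)//.
rewrite -(mulr_powRB1 _ q0) ?ler0n// -powR_inv1 ?(ltW S0)// -powRrM mulN1r powRN.
by ring.
Qed.

(** Dividing by the mean makes the linear terms of the tangent bounds cancel in the sum. *)
Let sum_tangent q y : 0 < \sum_i y i ->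
  \sum_i (1 + q * (y i / ((\sum_j y j) / k%:R) - 1)) = k%:R.
Proof.
move=> S0; rewrite big_split/= sumr_const card_ord -mulr_sumr sumrB -mulr_suml.
rewrite sumr_const card_ord invf_div mulrA [_ * k%:R]mulrC mulfK ?gt_eqF//.
by rewrite subrr mulr0 addr0.
Qed.

Lemma powR_mean q y : 1 < q -> (forall i, 0 <= y i) ->
  (\sum_i y i) `^ q <= k%:R `^ (q - 1) * \sum_i y i `^ q.
Proof.
move=> q1 y0; have q0 : 0 < q by lra.
have [->|S0] := eqVneq (\sum_i y i) 0.
  rewrite powR0 ?gt_eqF// mulr_ge0 ?powR_ge0// sumr_ge0// => i _.
  exact: powR_ge0.
have {}S0 := sum_gt0 y0 S0.
have : k%:R <= \sum_i (y i / ((\sum_j y j) / k%:R)) `^ q.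
  rewrite -[leLHS](sum_tangent q S0); apply: ler_sum => i _.
  by rewrite powR_ge_tangent// !divr_ge0// ?ler0n// ltW.
rewrite powR_mean_normalize// ler_pMl// ler_pdivlMr ?powR_gt0//.
by rewrite mul1r.
Qed.

(** A single entry off the mean makes its tangent bound strict, and summing over all entries would
    then give k < k. *)
Lemma powR_mean_eq q y : 1 < q -> (forall i, 0 <= y i) ->
  k%:R `^ (q - 1) * (\sum_i y i `^ q) <= (\sum_i y i) `^ q ->
  forall i, y i = (\sum_j y j) / k%:R.
Proof.
move=> q1 y0 h i; have q0 : 0 < q by lra.
have [S0|S0] := eqVneq (\sum_i y i) 0.
  rewrite S0 mul0r; apply/eqP.
  by move/eqP: S0; rewrite psumr_eq0// => /allP/(_ i); rewrite mem_index_enum => /(_ isT).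
have {}S0 := sum_gt0 y0 S0.
apply/eqP; apply: contraT => neq.
suff: k%:R < k%:R :> R by rewrite ltxx.
set u := (\sum_j y j) / k%:R in neq *.
have u0 : 0 < u by rewrite divr_gt0.
apply: (@lt_le_trans _ _ (\sum_i (y i / u) `^ q)).
  rewrite -[ltLHS](sum_tangent q S0) -/u.
  rewrite (bigD1 i)//= [ltRHS](bigD1 i)//= ltr_leD//.
    apply: powR_gt_tangent => //; first by rewrite divr_ge0// ltW.
    by apply: contra neq => /eqP/divr1_eq ->.
  apply: ler_sum => j _.
  by rewrite powR_ge_tangent// !divr_ge0// ltW.
rewrite powR_mean_normalize// -[leRHS]mul1r ler_pM2r// ler_pdivrMr ?powR_gt0//.
by rewrite mul1r.
Qed.

End FixedSize.
End PowerMeans.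

(** * Comparison and duality of l_p norms of nonnegative real families *)

Section LpNorms.
Variable R : realType.
Implicit Types (p c : R) (r s : \bar R).

(** Real counterpart of [lpnorm], to be applied to the moduli of the entries, so that comparison and
    duality are settled independently of the scalar field. *)
Definition lnorm r k (a : 'I_k -> R) : R :=
  match r with
  | EFin p => (\sum_i a i `^ p) `^ p^-1
  | +oo%E => \big[Num.max/0]_i a i
  | -oo%E => 0
  end.

Section FixedSize.
Variable k : nat.
Implicit Types a b : 'I_k -> R.

Lemma eq_lnorm r a b : a =1 b -> lnorm r a = lnorm r b.
Proof.
by move=> /funext ->.
Qed.

Lemma sum_powR_ge0 a p : 0 <= \sum_i a i `^ p.
Proof. by rewrite sumr_ge0// => i _; exact: powR_ge0. Qed.

Lemma lnorm_ge0 r a : 0 <= lnorm r a.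
Proof.
case: r => [p||]//=; first exact: powR_ge0.
exact: bigmax_ge_id.
Qed.

Lemma le_lnorm r a b : (1 <= r)%E -> (forall i, 0 <= a i) ->
  (forall i, a i <= b i) -> lnorm r a <= lnorm r b.
Proof.
case: r => [p||] r1 a0 ab; last by [].
  2: by apply: le_bigmax2 => i _; exact: ab.
move: r1; rewrite lee_fin => p1; have p0 : 0 < p by lra.
rewrite /lnorm ge0_ler_powR ?nnegrE ?sum_powR_ge0 ?invr_ge0 ?(ltW p0)//.
apply: ler_sum => i _.
by rewrite ge0_ler_powR ?nnegrE ?(ltW p0)// (le_trans (a0 i)).
Qed.

Lemma lnormZ r c a : (1 <= r)%E -> 0 <= c -> (forall i, 0 <= a i) ->
  lnorm r (fun i => c * a i) = c * lnorm r a.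
Proof.
case: r => [p||]//=; last first.
  move=> _ c0 a0; rewrite (big_morph _ (fun x y => maxr_pMr x y c0) (mulr0 c)).
  by [].
rewrite lee_fin => p1 c0 a0; have p0 : 0 < p by lra.
under eq_bigr do rewrite powRM//.
rewrite -mulr_sumr powRM ?powR_ge0 ?sum_powR_ge0// -powRrM mulfV ?gt_eqF//.
by rewrite powRr1.
Qed.

Lemma ler_lnorm r a i : (1 <= r)%E -> (forall i, 0 <= a i) -> a i <= lnorm r a.
Proof.
case: r => [p||]//=; last by move=> _ _; exact: (le_bigmax _ a).
rewrite lee_fin => p1 a0; have p0 : 0 < p by lra.
rewrite -[leLHS]powRr1// -[X in _ `^ X](mulfV (lt0r_neq0 p0)) powRrM.
rewrite ge0_ler_powR ?nnegrE ?sum_powR_ge0 ?powR_ge0 ?invr_ge0 ?(ltW p0)//.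
by rewrite (bigD1 i)//= lerDl sumr_ge0// => j _; exact: powR_ge0.
Qed.

Hypothesis k0 : (0 < k)%N.

Let kR0 : 0 < k%:R :> R. Proof. by rewrite ltr0n. Qed.

Lemma lnorm_const r c : (1 <= r)%E -> 0 <= c ->
  lnorm r ((fun=> c) : 'I_k -> R) = k%:R `^ inv_exp r * c.
Proof.
case: r => [p||]//=.
  rewrite lee_fin => p1 c0; have p0 : 0 < p by lra.
  rewrite sumr_const card_ord -[c `^ p *+ k]mulr_natl powRM ?powR_ge0//.
  by rewrite -powRrM mulfV ?gt_eqF// powRr1.
move=> _ c0; rewrite powRr0 mul1r; apply/le_anti/andP; split.
  by apply/bigmax_leP; split.
exact: (le_bigmax _ (fun=> c) (Ordinal k0)).
Qed.

(** Together with [lnorm_root], this exhibits the two sides of the norm comparison as roots of order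
    [p * t] of the two sides of the power mean inequality for the p-th powers of [a]. *)
Let lnorm_powR p t a : 1 <= p -> 1 < t -> (forall i, 0 <= a i) ->
  k%:R `^ (p^-1 - (p * t)^-1) * lnorm (p * t)%:E a =
  (k%:R `^ (t - 1) * \sum_i (a i `^ p) `^ t) `^ (p * t)^-1.
Proof.
move=> p1 t1 a0.
have S0 : 0 <= \sum_i (a i `^ p) `^ t by apply: sumr_ge0 => i _; exact: powR_ge0.
rewrite [RHS](powRM _ (powR_ge0 _ _) S0).
rewrite -[in RHS]powRrM.
have -> : (t - 1) * (p * t)^-1 = p^-1 - (p * t)^-1.
  by field; rewrite !gt_eqF//; lra.
have e : \sum_i a i `^ (p * t) = \sum_i (a i `^ p) `^ t.
  by apply: eq_bigr => i _; rewrite powRrM.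
by rewrite /lnorm e.
Qed.

Let lnorm_root p t a : 1 <= p -> 1 < t ->
  lnorm p%:E a = ((\sum_i a i `^ p) `^ t) `^ (p * t)^-1.
Proof.
move=> p1 t1; rewrite /= -powRrM; congr (_ `^ _).
by field; rewrite !gt_eqF//; lra.
Qed.

(** For finite [r] this is the power mean inequality with exponent [r / p]; for [+oo] the family is
    compared entrywise with the constant family equal to its maximum. *)
Lemma lnorm_comparison p r a : 1 <= p -> (p%:E < r)%E -> (forall i, 0 <= a i) ->
  lnorm p%:E a <= k%:R `^ (p^-1 - inv_exp r) * lnorm r a.
Proof.
move=> p1; have p0 : 0 < p by lra.
case: r => [r||]//; last first.
  move=> _ a0; set M := lnorm +oo%E a; have M0 : 0 <= M by exact: lnorm_ge0.
  have e := @lnorm_const p%:E M p1 M0; rewrite [inv_exp _]/= in e.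
  rewrite [inv_exp _]/= subr0 -e.
  by apply: le_lnorm => // i; apply: ler_lnorm; rewrite ?leey.
rewrite lte_fin => pr a0; rewrite -(divfK (lt0r_neq0 p0) r) [_ * p]mulrC.
have t1 : 1 < r / p by rewrite ltr_pdivlMr// mul1r.
rewrite (lnorm_root _ p1 t1) lnorm_powR// ge0_ler_powR ?nnegrE ?powR_ge0//.
- by rewrite invr_ge0 mulr_ge0//; lra.
- by rewrite mulr_ge0 ?powR_ge0// sum_powR_ge0.
- by apply: powR_mean => // i; exact: powR_ge0.
Qed.

Lemma lnorm_comparison_eq p r a : 1 <= p -> (p%:E < r)%E -> (forall i, 0 <= a i) ->
  k%:R `^ (p^-1 - inv_exp r) * lnorm r a <= lnorm p%:E a ->
  forall i, a i = k%:R `^ (- p^-1) * lnorm p%:E a.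
Proof.
move=> p1 pr a0 h i; have p0 : 0 < p by lra.
suff aE : forall i, a i = a (Ordinal k0).
  rewrite (eq_lnorm _ aE) lnorm_const//= mulrA -powRD ?(gt_eqF kR0) ?implybT//.
  by rewrite addNr powRr0 mul1r aE.
move: r pr h => [r||]//; last first.
  move=> _ h; set M := lnorm +oo%E a in h.
  have aM j : a j <= M by apply: ler_lnorm; rewrite ?leey.
  have M0 : 0 <= M by exact: lnorm_ge0.
  suff aM' : forall j, a j = M by move=> j; rewrite !aM'.
  (* One entry strictly below the maximum [M] would make the l_p norm strictly smaller than that of
     the constant family [M]. *)
  move=> j; apply/eqP; rewrite -[_ == _]negbK; apply/negP => neq.
  have lt : a j < M by rewrite lt_neqAle neq aM.
  have e := @lnorm_const p%:E M p1 M0; rewrite [inv_exp _]/= in e.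
  move: h; rewrite [inv_exp _]/= subr0 -e leNgt => /negP; apply; rewrite /lnorm.
  apply: gt0_ltr_powR; rewrite ?nnegrE ?sum_powR_ge0 ?invr_gt0//.
  rewrite (bigD1 j)//= [ltRHS](bigD1 j)//= ltr_leD//.
    by rewrite gt0_ltr_powR// nnegrE.
  by apply: ler_sum => l _; rewrite ge0_ler_powR ?nnegrE// ltW.
rewrite lte_fin => pr; rewrite -(divfK (lt0r_neq0 p0) r) [_ * p]mulrC.
have t1 : 1 < r / p by rewrite ltr_pdivlMr// mul1r.
rewrite (lnorm_root _ p1 t1) lnorm_powR// => h.
have {}h : k%:R `^ (r / p - 1) * \sum_i (a i `^ p) `^ (r / p) <=
    (\sum_i a i `^ p) `^ (r / p).
  rewrite leNgt; apply/negP => lt; move: h; rewrite leNgt => /negP; apply.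
  apply: gt0_ltr_powR; rewrite ?nnegrE ?powR_ge0//.
  - by rewrite invr_gt0 mulr_gt0//; lra.
  - by rewrite mulr_ge0 ?powR_ge0// sum_powR_ge0.
move=> j; apply: (powR_injective p0); rewrite ?nnegrE//.
by rewrite !(powR_mean_eq k0 t1 _ h)// => l; exact: powR_ge0.
Qed.

(* The test vector d^(1 / (p - 1)) turns the bound into ||d||_p' <= c, where p' is
   the conjugate exponent: the equality case of ||d||_1 <= k^(1/p) ||d||_p'. *)
Lemma lnorm_dual_eq p c (d : 'I_k -> R) : 1 <= p -> 0 <= c ->
  (forall i, 0 <= d i) ->
  (forall t : 'I_k -> R, (forall i, 0 <= t i) ->
    \sum_i t i * d i <= c * lnorm p%:E t) ->
  \sum_i d i = c * k%:R `^ p^-1 ->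
  forall i, d i = (\sum_j d j) / k%:R.
Proof.
rewrite le_eqVlt => /predU1P[<-|p1] c0 d0 h hc.
  (* For p = 1, testing on the unit vectors gives [d i <= c], and the prescribed total leaves no
     slack in any of these bounds. *)
  have {}hc : \sum_i d i = c * k%:R by rewrite hc invr1 powRr1 ?ler0n.
  have dc i : d i <= c.
    have /h : forall j, 0 <= ((j == i)%:R : R) by move=> j; rewrite ler0n.
    rewrite (bigD1 i)//= eqxx mul1r big1 ?addr0; last first.
      by move=> j /negPf ->; rewrite mul0r.
    rewrite invr1 (bigD1 i)//= eqxx powR1 big1 ?addr0.
      by rewrite powR1 mulr1.
    by move=> j /negPf ->; rewrite powR0// oner_eq0.
  have : \sum_i (c - d i) = 0.
    by rewrite sumrB sumr_const card_ord hc mulr_natr subrr.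
  move=> /eqP; rewrite psumr_eq0; last by move=> i _; rewrite subr_ge0.
  move=> /allP e i; have := e i; rewrite mem_index_enum => /(_ isT).
  by rewrite subr_eq0 hc mulfK ?(gt_eqF kR0)// => /eqP ->.
set q := p / (p - 1); have p0 : 0 < p by lra.
have pm : 0 < p - 1 by lra.
have q1 : 1 < q by rewrite /q ltr_pdivlMr//; lra.
have q0 : 0 < q by lra.
apply: (powR_mean_eq k0 q1 d0).
pose t i := d i `^ (q - 1).
have := h t (fun i => powR_ge0 _ _).
set S := \sum_i d i `^ q; have S0 : 0 <= S by exact: sum_powR_ge0.
have -> : \sum_i t i * d i = S.
  by apply: eq_bigr => i _; rewrite mulrC mulr_powRB1.
have -> : lnorm p%:E t = S `^ p^-1.
  rewrite /lnorm; congr (_ `^ _); apply: eq_bigr => i _; rewrite -powRrM.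
  by congr (_ `^ _); rewrite /q; field; rewrite gt_eqF.
move: S0; rewrite le_eqVlt => /predU1P[<- _|S0 hS]; first by rewrite mulr0 powR_ge0.
(* Dividing S <= c S^(1/p) by S^(1/p) gives S^(1/q) <= c, because 1/q = 1 - 1/p. *)
have {}hS : S <= c `^ q.
  rewrite -[leLHS]powRr1 ?(ltW S0)// -(mulVf (lt0r_neq0 q0)) powRrM.
  rewrite ge0_ler_powR ?nnegrE ?powR_ge0// ?(ltW q0)//.
  have -> : q^-1 = 1 - p^-1 by rewrite /q; field; rewrite !gt_eqF.
  rewrite powRB ?(gt_eqF S0) ?implybT// powRr1 ?(ltW S0)//.
  by rewrite ler_pdivrMr ?powR_gt0.
rewrite hc powRM ?powR_ge0// -powRrM.
have -> : p^-1 * q = q - 1 by rewrite /q; field; rewrite !gt_eqF.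
by rewrite mulrC ler_wpM2r// powR_ge0.
Qed.

End FixedSize.
End LpNorms.

(** * Continuity of finite sums and closedness of the unit ball *)

Section Continuity.
Local Open Scope classical_set_scope.

Lemma continuous_sumr (R : realType) (T : topologicalType) k
    (f : 'I_k -> T -> R) :
  (forall i, continuous (f i)) -> continuous (fun u => \sum_i f i u).
Proof.
move=> fc; elim: (index_enum _) => [|i s IHs].
  by under eq_fun do rewrite big_nil; move=> u; exact: cvg_cst.
under eq_fun do rewrite big_cons.
by move=> u; apply: (cvgD (fc i u) (IHs u)).
Qed.

Lemma closed_unit_ball_rV (R : realType) k :
  closed [set u : 'rV[R]_k | `|u| <= 1].
Proof.
exact: (@preimage_closed 'rV[R]_k R (fun u => `|u|) _
  (fun x _ => @norm_continuous _ _ x) (@closed_le R 1)).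
Qed.

End Continuity.

(** * The modulus on a scalar field covering both R and R[i] *)

Section ScalarField.
Variables (R : realType) (F : numFieldType) (absF : F -> R).
Variables (iota : {rmorphism R -> F}) (I : F).
Hypothesis normE : forall z, `|z| = iota (absF z).
Hypothesis iota_le : {mono iota : a b / a <= b}.
Hypothesis absI : absF I <= 1.
(** The bounds on the two coordinates ensure that vectors with entries of modulus at most 1 have
    coordinates in the unit box, which is compact. *)
Hypothesis decompose : forall z, exists a b : R,
  [/\ `|a| <= absF z, `|b| <= absF z & z = iota a + iota b * I].
Implicit Types (a b c : R) (z w : F).

Lemma iota_inj : injective iota. Proof. exact: inc_inj iota_le. Qed.

Lemma iota_ge0 a : (0 <= iota a) = (0 <= a).
Proof. by rewrite -iota_le rmorph0. Qed.

Lemma abs_ge0 z : 0 <= absF z.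
Proof. by rewrite -iota_le rmorph0 -normE. Qed.
Hint Resolve abs_ge0 : core.

Lemma abs0 : absF 0 = 0.
Proof. by apply: iota_inj; rewrite -normE normr0 rmorph0. Qed.

Lemma abs_eq0 z : (absF z == 0) = (z == 0).
Proof. by rewrite -(inj_eq iota_inj) rmorph0 -normE normr_eq0. Qed.

Lemma absM z w : absF (z * w) = absF z * absF w.
Proof. by apply: iota_inj; rewrite rmorphM/= -!normE normrM. Qed.

Lemma absN z : absF (- z) = absF z.
Proof. by apply: iota_inj; rewrite -!normE normrN. Qed.

Lemma abs_add z w : absF (z + w) <= absF z + absF w.
Proof. by rewrite -iota_le rmorphD/= -!normE ler_normD. Qed.

Lemma abs_sum (J : finType) (f : J -> F) :
  absF (\sum_j f j) <= \sum_j absF (f j).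
Proof.
rewrite -iota_le rmorph_sum/= -normE (le_trans (ler_norm_sum _ _ _))//.
by apply: ler_sum => j _; rewrite normE.
Qed.

Lemma abs_iota a : absF (iota a) = `|a|.
Proof.
apply: iota_inj; rewrite -normE; have [a0|a0] := leP 0 a.
  by rewrite (ger0_norm a0) ger0_norm// iota_ge0.
rewrite (ltr0_norm a0) rmorphN/= ler0_norm//.
by rewrite -oppr_ge0 -rmorphN/= iota_ge0 oppr_ge0 ltW.
Qed.

Lemma abs_iota_ge0 a : 0 <= a -> absF (iota a) = a.
Proof. by move=> a0; rewrite abs_iota ger0_norm. Qed.

Lemma abs1 : absF 1 = 1.
Proof. by rewrite -(rmorph1 iota) abs_iota normr1. Qed.

Lemma dist_abs z w : `|absF z - absF w| <= absF (z - w).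
Proof.
have H z' w' : absF z' <= absF w' + absF (z' - w').
  by rewrite -{1}(subrK w' z') addrC abs_add.
by rewrite ler_distl lerBlDr H andbT -(absN (z - w)) opprB H.
Qed.

Lemma abs_mulmx_le k m (B : 'M[F]_(k, m)) (x : 'cV[F]_m) c i :
  (forall j, absF (x j 0) <= c) ->
  absF ((B *m x) i 0) <= (\sum_j absF (B i j)) * c.
Proof.
move=> xc; rewrite mxE mulr_suml (le_trans (abs_sum _))//.
by apply: ler_sum => j _; rewrite absM ler_wpM2l.
Qed.

(** * Existence of maxima through real coordinates *)

Section Compactness.
Local Open Scope classical_set_scope.
Variable m : nat.
Implicit Types (x y : 'cV[F]_m) (u : 'rV[R]_(m + m)).

(* Vectors over F are parametrized by real coordinates because only R carries
   the compactness theory; for F = R half of the coordinates are redundant. *)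
Definition of_coords u : 'cV[F]_m :=
  \col_j (iota (u 0 (lshift m j)) + iota (u 0 (rshift m j)) * I).

Lemma abs_of_coordsB u (w : 'rV[R]_(m + m)) j :
  absF ((of_coords u - of_coords w) j 0) <= `|u - w| *+ 2.
Proof.
have coordB l : `|u 0 l - w 0 l| <= `|u - w|.
  have -> : u 0 l - w 0 l = (u - w) 0 l by rewrite !mxE.
  rewrite [leRHS]/Num.norm/= mx_normrE.
  exact: (le_bigmax _ (fun ij => `|(u - w) ij.1 ij.2|) (0, l)).
rewrite !mxE opprD addrACA -mulrBl -!rmorphB/= (le_trans (abs_add _ _))//.
rewrite absM !abs_iota mulr2n lerD ?coordB//.
by rewrite (le_trans (ler_wpM2l _ absI))// mulr1 coordB.
Qed.

Lemma continuous_abs_mulmx k (B : 'M[F]_(k, m)) i :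
  continuous (fun u => absF ((B *m of_coords u) i 0)).
Proof.
move=> u; apply/(@cvgrPdist_le _ _ _ (nbhs u) (nbhs_filter u)) => e e0.
set c := \sum_j absF (B i j); have c0 : 0 <= c by rewrite sumr_ge0.
(* The map is Lipschitz with constant [c *+ 2]; the added 1 keeps the denominator positive when row
   [i] of [B] vanishes. *)
have d0 : 0 < e / (c *+ 2 + 1) by rewrite divr_gt0// ltr_wpDl// mulrn_wge0.
near=> w.
have uw : `|u - w| <= e / (c *+ 2 + 1).
  by near: w; apply: cvgr_dist_le => //; exact: cvg_id.
rewrite (le_trans (dist_abs _ _))//.
have -> : (B *m of_coords u) i 0 - (B *m of_coords w) i 0 =
    (B *m (of_coords u - of_coords w)) i 0.
  by rewrite mulmxBr !mxE.
rewrite (le_trans (abs_mulmx_le B i (abs_of_coordsB u w)))// -/c.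
move: uw; rewrite ler_pdivlMr ?ltr_wpDl ?mulrn_wge0// => uw.
have := normr_ge0 (u - w); move: uw; move: `|u - w| => z h z0.
by rewrite (le_trans _ h)// [z * _]mulrDr mulr1 !mulrnAr [c * z]mulrC lerDl.
Unshelve. all: by end_near.
Qed.

(** The coordinates of [K] inside the unit box form a compact set that [of_coords] maps onto [K], so
    the extreme value theorem on real row vectors applies. *)
Lemma maximum_attained (f : 'cV[F]_m -> R) (K : set 'cV[F]_m) :
  continuous (f \o of_coords) -> closed (of_coords @^-1` K) -> K !=set0 ->
  (forall x, K x -> forall j, absF (x j 0) <= 1) ->
  exists2 x, K x & forall y, K y -> f y <= f x.
Proof.
move=> fc Kcl Kne K1.
pose box : set 'rV[R]_(m + m) := [set u | `|u| <= 1].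
have box_closed : closed box.
  exact: closed_unit_ball_rV.
have cpt : compact (box `&` of_coords @^-1` K).
  apply: bounded_closed_compact; last exact: closedI.
  exists 1; split=> // c c1 u [u1 _]; exact: le_trans u1 (ltW c1).
have lift x : K x -> exists2 u, of_coords u = x & box u.
  move=> Kx; have /choice[g gP] : forall j, exists ab : R * R,
      [/\ `|ab.1| <= 1, `|ab.2| <= 1 & x j 0 = iota ab.1 + iota ab.2 * I].
    move=> j; have [a [b [a1 b1 e]]] := decompose (x j 0).
    by exists (a, b); split=> //=; rewrite (le_trans _ (K1 x Kx j)).
  exists (row_mx (\row_j (g j).1) (\row_j (g j).2)).
    apply/colP => j; rewrite mxE row_mxEl row_mxEr !mxE.
    by have [_ _ ->] := gP j.
  rewrite /box/= [leLHS]/Num.norm/= mx_normrE; apply/bigmax_leP; split=> // -[l0 l] _.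
  rewrite [l0]ord1 -[l]splitK.
  by case: (fintype.split l) => j /=; rewrite ?row_mxEl ?row_mxEr mxE; have [] := gP j.
have ne : (box `&` of_coords @^-1` K) !=set0.
  have [x Kx] := Kne; have [u ux ub] := lift _ Kx.
  by exists u; split=> //=; rewrite ux.
have [u /set_mem[_ Ku] umax] :=
  EVT_max_rV ne cpt (continuous_subspaceT (A := _ `&` _) fc).
exists (of_coords u) => // y Ky; have [w wy wb] := lift _ Ky.
by rewrite -wy; apply: umax; apply/mem_set; split=> //=; rewrite wy.
Qed.

End Compactness.

(** * Norms of vectors over the scalar field *)

Lemma lpnormE r k (x : 'cV[F]_k) :
  lpnorm absF r x = lnorm r (fun i => absF (x i 0)).
Proof. by case: r. Qed.

Lemma lpnorm_ge0 r k (x : 'cV[F]_k) : 0 <= lpnorm absF r x.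
Proof. by rewrite lpnormE lnorm_ge0. Qed.

Lemma abs_le_lpnorm r k (x : 'cV[F]_k) i :
  (1 <= r)%E -> absF (x i 0) <= lpnorm absF r x.
Proof.
by move=> r1; rewrite lpnormE; apply: (@ler_lnorm _ k r (fun i => absF (x i 0))).
Qed.

Lemma lpnorm_gt0 r k (x : 'cV[F]_k) :
  (1 <= r)%E -> x != 0 -> 0 < lpnorm absF r x.
Proof.
move=> r1; apply: contraNT; rewrite -leNgt => x0; apply/eqP/colP => i.
apply/eqP; rewrite mxE -abs_eq0 eq_le abs_ge0 andbT.
exact: le_trans (abs_le_lpnorm x i r1) x0.
Qed.

Lemma lpnormZ r k z (x : 'cV[F]_k) :
  (1 <= r)%E -> lpnorm absF r (z *: x) = absF z * lpnorm absF r x.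
Proof.
move=> r1; rewrite !lpnormE -lnormZ//.
by congr lnorm; apply/funext => i; rewrite mxE absM.
Qed.

Lemma lpnorm_le_flat r k (x : 'cV[F]_k) c : (0 < k)%N -> (1 <= r)%E -> 0 <= c ->
  (forall i, absF (x i 0) <= c) -> lpnorm absF r x <= k%:R `^ inv_exp r * c.
Proof.
by move=> k0 r1 c0 xc; rewrite lpnormE -(lnorm_const k0)//; apply: le_lnorm.
Qed.

Lemma lpnorm_flat r k (x : 'cV[F]_k) c : (0 < k)%N -> (1 <= r)%E ->
  (forall i, absF (x i 0) = c) -> lpnorm absF r x = k%:R `^ inv_exp r * c.
Proof.
move=> k0 r1 xc; have c0 : 0 <= c by rewrite -(xc (Ordinal k0)).
by rewrite lpnormE -(lnorm_const k0)//; congr lnorm; apply/funext => i.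
Qed.

Lemma lpnorm1 k (x : 'cV[F]_k) : lpnorm absF 1%:E x = \sum_i absF (x i 0).
Proof.
rewrite /lpnorm invr1 powRr1; last by rewrite sumr_ge0// => i _; exact: powR_ge0.
by apply: eq_bigr => i _; rewrite powRr1.
Qed.

Lemma lpnorm2_sqr k (x : 'cV[F]_k) :
  lpnorm absF 2%:E x ^+ 2 = \sum_i absF (x i 0) ^+ 2.
Proof.
rewrite /lpnorm -powR_mulrn ?powR_ge0// -powRrM mulVf ?pnatr_eq0// powRr1.
  by apply: eq_bigr => i _; rewrite powR_mulrn.
by rewrite sumr_ge0// => i _; exact: powR_ge0.
Qed.

(** * Operator norms and the sufficiency of a flat vector *)

Section OperatorNorms.
Variables n m : nat.
Hypotheses (n0 : (0 < n)%N) (m0 : (0 < m)%N).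
Variable A : 'M[F]_(n, m).
Implicit Types (x y v : 'cV[F]_m) (p : R) (r s q : \bar R).

Let nR0 : 0 < n%:R :> R. Proof. by rewrite ltr0n. Qed.
Let mR0 : 0 < m%:R :> R. Proof. by rewrite ltr0n. Qed.

Local Notation opn r s := (opnorm absF r s A).

Lemma const_mx1_neq0 : const_mx 1 != 0 :> 'cV[F]_m.
Proof.
by apply/eqP => /colP/(_ (Ordinal m0))/eqP; rewrite !mxE oner_eq0.
Qed.

Lemma opnorm_ub r s x : (1 <= r)%E -> (1 <= s)%E ->
  lpnorm absF s (A *m x) <= opn r s * lpnorm absF r x.
Proof.
move=> r1 s1; have [->|x0] := eqVneq x 0.
  rewrite mulmx0 -[X in lpnorm _ s X](scale0r 0) -[X in lpnorm _ r X](scale0r 0).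
  by rewrite !lpnormZ// abs0 !mul0r mulr0.
rewrite -ler_pdivrMr ?lpnorm_gt0//; apply: ub_le_sup; last by exists x.
(* The supremum dominates the quotients only once they are known to be bounded; the sum of all entry
   moduli supplies a crude bound. *)
set c := \sum_i \sum_j absF (A i j); exists (n%:R `^ inv_exp s * c) => _ [y y0 <-].
rewrite ler_pdivrMr ?lpnorm_gt0// -mulrA.
have c0 : 0 <= c by do 2!(apply: sumr_ge0 => ? _).
apply: lpnorm_le_flat; rewrite ?mulr_ge0 ?lpnorm_ge0// => i.
rewrite (le_trans (abs_mulmx_le A i (fun j => abs_le_lpnorm y j r1)))//.
rewrite ler_wpM2r ?lpnorm_ge0// /c (bigD1 i)//= lerDl.
by do 2!(apply: sumr_ge0 => ? _).
Qed.

Lemma opnorm_le r s c : (1 <= r)%E ->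
  (forall x, x != 0 -> lpnorm absF s (A *m x) <= c * lpnorm absF r x) ->
  opn r s <= c.
Proof.
move=> r1 h; apply: ge_sup.
  by eexists; exists (const_mx 1) => //=; exact: const_mx1_neq0.
by move=> _ [x x0 <-]; rewrite ler_pdivrMr ?lpnorm_gt0// h.
Qed.

Lemma opnorm_ge0 r s : (1 <= r)%E -> (1 <= s)%E -> 0 <= opn r s.
Proof.
move=> r1 s1; have x0 := lpnorm_gt0 r1 const_mx1_neq0.
rewrite -(pmulr_lge0 _ x0); apply: le_trans (opnorm_ub _ r1 s1).
exact: lpnorm_ge0.
Qed.

Lemma opnorm_comparison p q r s : 1 <= p -> (p%:E < r)%E ->
  (1 <= s)%E -> (s < q)%E ->
  opn r s <= m%:R `^ (p^-1 - inv_exp r) * n%:R `^ (inv_exp s - inv_exp q) *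
    opn p%:E q.
Proof.
move=> p1 pr s1 sq; have r1 : (1 <= r)%E by rewrite (le_trans _ (ltW pr))// lee_fin.
have q1 : (1 <= q)%E by rewrite (le_trans s1)// ltW.
case: s s1 sq => [s||] s1 sq; last by [].
  2: by move: sq; rewrite ltNge leey.
move: s1; rewrite lee_fin => s1; apply: opnorm_le => // x _.
rewrite lpnormE (le_trans (lnorm_comparison n0 s1 sq _))// -lpnormE.
rewrite (le_trans (ler_wpM2l _ (opnorm_ub x (_ : (1 <= p%:E)%E) q1)))//.
rewrite [X in _ <= X * _ * _]mulrC -!mulrA ler_wpM2l ?powR_ge0// mulrCA.
rewrite ler_wpM2l ?opnorm_ge0// !lpnormE.
exact: lnorm_comparison.
Qed.

Lemma E_inf1_flat p q v tau : 1 <= p -> (1 < q)%E ->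
  (forall j, absF (v j 0) = 1) -> (forall i, absF ((A *m v) i 0) = tau) ->
  tau = m%:R `^ p^-1 * n%:R `^ (- inv_exp q) * opn p%:E q ->
  E_inf1 absF p q A.
Proof.
move=> p1 q1 v1 Av tauE r s pr s1 sq; apply/le_anti.
rewrite opnorm_comparison//=.
have r1 : (1 <= r)%E by rewrite (le_trans _ (ltW pr))// lee_fin.
(* Testing on [v] yields n^(1/s) tau <= m^(1/r) ||A||_{r,s}, the reverse bound once the value of
   [tau] is inserted. *)
have := opnorm_ub v r1 s1.
rewrite (lpnorm_flat m0 r1 v1) (lpnorm_flat n0 s1 Av) mulr1 tauE.
rewrite -ler_pdivrMr ?powR_gt0//; apply: le_trans.
rewrite !powRB ?(gt_eqF mR0) ?(gt_eqF nR0) ?implybT// powRN.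
by rewrite le_eqVlt; apply/orP; left; apply/eqP; ring.
Qed.

End OperatorNorms.

(** * Inner product, adjoint and squared Euclidean norm *)

Section InnerProduct.
Variable conj : {rmorphism F -> F}.
Hypothesis conjE : forall z, conj z * z = iota (absF z ^+ 2).
Hypothesis conj_iota : forall a, conj (iota a) = iota a.
Hypothesis conjK : involutive conj.

Definition ip k (x y : 'cV[F]_k) : F := (adjmx conj x *m y) 0 0.

Definition sqnorm k (x : 'cV[F]_k) : R := \sum_i absF (x i 0) ^+ 2.

Lemma ipE k (x y : 'cV[F]_k) : ip x y = \sum_i conj (x i 0) * y i 0.
Proof. by rewrite /ip mxE; apply: eq_bigr => i _; rewrite !mxE. Qed.

Lemma ipxx k (x : 'cV[F]_k) : ip x x = iota (sqnorm x).
Proof. by rewrite ipE rmorph_sum; apply: eq_bigr => i _; rewrite conjE. Qed.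

Lemma ipBr k (x y w : 'cV[F]_k) : ip x (y - w) = ip x y - ip x w.
Proof. by rewrite /ip mulmxBr !mxE. Qed.

Lemma ipBl k (x y w : 'cV[F]_k) : ip (x - y) w = ip x w - ip y w.
Proof.
rewrite !ipE -sumrB; apply: eq_bigr => i _.
by rewrite !mxE rmorphB mulrBl.
Qed.

Lemma ipZr k z (x y : 'cV[F]_k) : ip x (z *: y) = z * ip x y.
Proof. by rewrite /ip -scalemxAr mxE. Qed.

Lemma ipZl k a (x y : 'cV[F]_k) : ip (iota a *: x) y = iota a * ip x y.
Proof.
rewrite !ipE mulr_sumr; apply: eq_bigr => i _.
by rewrite mxE rmorphM/= conj_iota mulrA.
Qed.

Lemma sqnorm_ge0 k (x : 'cV[F]_k) : 0 <= sqnorm x.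
Proof. by rewrite sumr_ge0// => i _; rewrite sqr_ge0. Qed.

Lemma sqnorm_eq0 k (x : 'cV[F]_k) : sqnorm x = 0 -> x = 0.
Proof.
move=> /eqP; rewrite psumr_eq0; last by move=> i _; rewrite sqr_ge0.
move=> /allP x0; apply/colP => i; apply/eqP; rewrite mxE.
by have := x0 i; rewrite mem_index_enum sqrf_eq0 abs_eq0 => /(_ isT).
Qed.

Lemma sqnormZ k z (x : 'cV[F]_k) : sqnorm (z *: x) = absF z ^+ 2 * sqnorm x.
Proof.
by rewrite /sqnorm mulr_sumr; apply: eq_bigr => i _; rewrite mxE absM exprMn.
Qed.

Lemma sqnorm_flat k (x : 'cV[F]_k) c :
  (forall i, absF (x i 0) = c) -> sqnorm x = k%:R * c ^+ 2.
Proof.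
move=> xc; rewrite /sqnorm; under eq_bigr do rewrite xc.
by rewrite sumr_const card_ord mulr_natl.
Qed.

Section Adjoint.
Variables n m : nat.
Variable A : 'M[F]_(n, m).

Lemma ip_mulmxl (x : 'cV[F]_m) (y : 'cV[F]_n) :
  ip (A *m x) y = ip x (adjmx conj A *m y).
Proof.
rewrite /ip mulmxA; congr ((_ *m _) 0 0).
by rewrite /adjmx trmx_mul map_mxM.
Qed.

Lemma ip_mulmxr (x : 'cV[F]_m) (y : 'cV[F]_n) :
  ip (adjmx conj A *m y) x = ip y (A *m x).
Proof.
rewrite /ip mulmxA; congr ((_ *m _) 0 0).
rewrite /adjmx trmx_mul map_mxM; congr (_ *m _).
by apply/matrixP => i j; rewrite !mxE conjK.
Qed.

(** Pairing the eigenvector equation with [x] makes the eigenvalue a Rayleigh quotient, which ties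
    it to norms of [A *m x]. *)
Lemma eigenpair_sqnorm x lam :
  eigenpair (adjmx conj A *m A) x lam ->
  iota (sqnorm (A *m x)) = lam * iota (sqnorm x).
Proof.
by move=> [_ e]; rewrite -!ipxx ip_mulmxl mulmxA e ipZr.
Qed.

End Adjoint.

(** * Extremal vectors: flatness, the eigenvector property, the largest eigenvalue *)

Section FlatVectors.
Variables n m : nat.
Hypotheses (n0 : (0 < n)%N) (m0 : (0 < m)%N).
Variable A : 'M[F]_(n, m).
Implicit Types (x y v : 'cV[F]_m) (p : R) (q : \bar R).

Let nR0 : 0 < n%:R :> R. Proof. by rewrite ltr0n. Qed.
Let mR0 : 0 < m%:R :> R. Proof. by rewrite ltr0n. Qed.

Local Notation opn r s := (opnorm absF r s A).
Local Notation AA := (adjmx conj A *m A).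

Local Open Scope classical_set_scope.

Lemma opnorm_inf1_attained : exists2 v : 'cV[F]_m, (forall j, absF (v j 0) <= 1) &
  opn +oo%E 1%:E <= lpnorm absF 1%:E (A *m v).
Proof.
have fc : continuous ((fun x => \sum_i absF ((A *m x) i 0)) \o @of_coords m).
  apply: (@continuous_sumr _ _ _ (fun i u => absF ((A *m of_coords u) i 0))) => i.
  exact: continuous_abs_mulmx.
pose K : set 'cV[F]_m := [set x | forall j, absF (x j 0) <= 1].
have Kcl : closed (@of_coords m @^-1` K).
  (* Writing an entry of x as an entry of [1%:M *m x] lets [continuous_abs_mulmx] apply to the
     constraints as well. *)
  have -> : @of_coords m @^-1` K =
      \bigcap_j ((fun u => absF ((1%:M *m @of_coords m u) j 0)) @^-1` [set a | a <= 1]).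
    apply/seteqP; split=> u /= h j; first by rewrite /= mul1mx.
    by have := h j Logic.I; rewrite /= mul1mx.
  apply: closed_bigI => j _.
  apply: preimage_closed; last exact: closed_le.
  by move=> u _; exact: continuous_abs_mulmx.
have Kne : K !=set0 by exists 0 => j; rewrite mxE abs0.
have [v v1 vmax] := maximum_attained fc Kcl Kne (fun x Kx => Kx).
exists v => //; apply: opnorm_le => //; rewrite ?leey// => x x0.
have oo1 : (1 <= +oo :> \bar R)%E by rewrite leey.
have N0 := lpnorm_gt0 oo1 x0; set N := lpnorm absF +oo%E x in N0 *.
have aN : absF (iota N^-1) = N^-1 by rewrite abs_iota_ge0// invr_ge0 ltW.
have /vmax : forall j, absF ((iota N^-1 *: x) j 0) <= 1.
  move=> j; rewrite mxE absM aN mulrC ler_pdivrMr// mul1r.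
  exact: abs_le_lpnorm.
by rewrite -!lpnorm1 -scalemxAr lpnormZ// aN mulrC ler_pdivrMr.
Qed.

(** With c = n^(1-1/q) ||A||_{p,q}, the maximizer satisfies c m^(1/p) <= ||Av||_1 <= n^(1-1/q)
    ||Av||_q <= c ||v||_p <= c m^(1/p) ||v||_oo <= c m^(1/p). All terms agree; cancelling c > 0
    isolates the equality case for [v], and the left part gives the one for [A *m v]. *)
Lemma E_inf1_flat_vector p q : 1 <= p -> (1 < q)%E -> E_inf1 absF p q A ->
  0 < opn p%:E q ->
  exists v, [/\ (forall j, absF (v j 0) = 1) &
    forall i, absF ((A *m v) i 0) =
      m%:R `^ p^-1 * n%:R `^ (- inv_exp q) * opn p%:E q].
Proof.
move=> p1 q1 E N0; set N := opn p%:E q in N0 *.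
have oo1 : (1 <= +oo :> \bar R)%E by rewrite leey.
have [v v1 vmax] := opnorm_inf1_attained; exists v.
rewrite (E +oo%E 1%:E (ltry _) (lexx _) q1) -/N [inv_exp +oo]/= subr0 in vmax.
rewrite [inv_exp 1%:E]/= invr1 in vmax.
set c := n%:R `^ (1 - inv_exp q) * N.
have c0 : 0 < c by rewrite mulr_gt0// powR_gt0.
have h1 : lpnorm absF 1%:E (A *m v) <= n%:R `^ (1 - inv_exp q) * lpnorm absF q (A *m v).
  have := lnorm_comparison n0 (lexx 1) q1 (fun i => abs_ge0 ((A *m v) i 0)).
  by rewrite invr1 -!lpnormE.
have h2 : lpnorm absF q (A *m v) <= N * lpnorm absF p%:E v.
  by apply: opnorm_ub => //; rewrite ?lee_fin// ltW.
have h3 : lpnorm absF +oo%E v <= 1.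
  have := lpnorm_le_flat m0 oo1 ler01 v1; rewrite powRr0 mulr1; exact.
have h4 : lpnorm absF p%:E v <= m%:R `^ p^-1 * lpnorm absF +oo%E v.
  have := lnorm_comparison m0 p1 (ltry p) (fun j => abs_ge0 (v j 0)).
  by rewrite [inv_exp _]/= subr0 -!lpnormE.
have vp : m%:R `^ p^-1 <= lpnorm absF p%:E v.
  rewrite -(ler_pM2l c0) (le_trans _ (le_trans h1 _))//.
    by rewrite mulrC /c mulrA.
  by rewrite /c -mulrA ler_wpM2l ?powR_ge0.
have vp' : m%:R `^ p^-1 * lpnorm absF +oo%E v <= lpnorm absF p%:E v.
  by rewrite (le_trans _ vp)// -[leRHS]mulr1 ler_wpM2l ?powR_ge0.
have vpE : lpnorm absF p%:E v = m%:R `^ p^-1.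
  apply/le_anti; rewrite vp andbT (le_trans h4)// -[leRHS]mulr1.
  by rewrite ler_wpM2l ?powR_ge0.
have Av1 : lpnorm absF 1%:E (A *m v) = c * m%:R `^ p^-1.
  apply/le_anti/andP; split; last by rewrite mulrC /c mulrA.
  by rewrite (le_trans h1)// /c -mulrA ler_wpM2l ?powR_ge0// -vpE.
split=> [j|i].
  have := lnorm_comparison_eq m0 p1 (ltry p) (fun j => abs_ge0 (v j 0)).
  rewrite -!lpnormE [inv_exp _]/= subr0 => /(_ vp' j) ->.
  by rewrite vpE -powRD ?addNr ?powRr0// (gt_eqF mR0) implybT.
have := lnorm_comparison_eq n0 (lexx 1) q1 (fun i => abs_ge0 ((A *m v) i 0)).
rewrite -!lpnormE invr1 Av1.
have -> : n%:R `^ (1 - inv_exp q) * lpnorm absF q (A *m v) <= c * m%:R `^ p^-1.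
  by rewrite /c -mulrA ler_wpM2l ?powR_ge0// -vpE.
move=> /(_ isT i) ->.
rewrite /c !mulrA -powRD ?(gt_eqF nR0) ?implybT// addrA addNr add0r.
by ring.
Qed.

(* Testing <A^*A v, x> <= tau ||A x||_1 on vectors x with the phases of A^*A v
   shows that all its entries have modulus lam = n tau^2 / m, and then
   ||A^*A v - lam v||_2^2 expands to 0. *)
Lemma E_inf1_eigenpair p q v tau : 1 <= p -> (1 < q)%E ->
  (forall j, absF (v j 0) = 1) ->
  (forall i, absF ((A *m v) i 0) = tau) ->
  tau = m%:R `^ p^-1 * n%:R `^ (- inv_exp q) * opn p%:E q ->
  0 <= tau -> eigenpair AA v (iota (n%:R * tau ^+ 2 / m%:R)).
Proof.
move=> p1 q1 v1 Av tauE tau0.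
have v0 : v != 0.
  apply/eqP => /colP/(_ (Ordinal m0)) e.
  by have := v1 (Ordinal m0); rewrite e mxE abs0 => /eqP; rewrite eq_sym oner_eq0.
split=> //; set lam := n%:R * _ / _.
have lamE : m%:R * lam = n%:R * tau ^+ 2.
  by rewrite /lam mulrC divfK// gt_eqF.
set c := n%:R `^ (1 - inv_exp q) * opn p%:E q.
have ntau : n%:R * tau = c * m%:R `^ p^-1.
  rewrite tauE /c powRD ?(gt_eqF nR0) ?implybT// powRr1 ?ler0n//.
  by ring.
have p1' : (1 <= p%:E)%E by rewrite lee_fin.
have c0 : 0 <= c by rewrite mulr_ge0 ?powR_ge0// opnorm_ge0// ltW.
set z := AA *m v; pose d j := absF (z j 0).
have d0 j : 0 <= d j by exact: abs_ge0.
have zA y : ip z y = ip (A *m v) (A *m y) by rewrite /z -mulmxA ip_mulmxr.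
have zv : ip z v = iota (m%:R * lam).
  by rewrite zA ipxx (sqnorm_flat Av) lamE.
have vz : ip v z = iota (m%:R * lam).
  by rewrite /z -mulmxA -ip_mulmxl ipxx (sqnorm_flat Av) lamE.
have abs_conj w : absF (conj w) = absF w.
  have [->|w0] := eqVneq w 0; first by rewrite rmorph0.
  apply: (mulIf (x := absF w)); first by rewrite abs_eq0.
  by rewrite -absM conjE abs_iota_ge0 ?sqr_ge0.
have key (t : 'I_m -> R) : (forall j, 0 <= t j) ->
    \sum_j t j * d j <= tau * c * lnorm p%:E t.
  (* The entries of [x] have modulus [t j] and the phase of [z j 0]; where [d j] is 0 the entry is
     0, so [xt] is only an inequality. *)
  move=> t0; pose x : 'cV[F]_m := \col_j (iota (t j / d j) * z j 0).
  have xt j : absF (x j 0) <= t j.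
    rewrite mxE absM abs_iota_ge0 ?divr_ge0// -/(d j).
    have [->|dj] := eqVneq (d j) 0; first by rewrite mulr0.
    by rewrite divfK.
  have -> : \sum_j t j * d j = absF (ip z x).
    rewrite ipE -[LHS]abs_iota_ge0; last by rewrite sumr_ge0// => j _; rewrite mulr_ge0.
    rewrite rmorph_sum; congr absF; apply: eq_bigr => j _.
    rewrite [x j 0]mxE mulrCA conjE -rmorphM/= -/(d j); congr (iota _).
    have [->|dj] := eqVneq (d j) 0; first by rewrite !mulr0 expr0n mulr0.
    by field.
  rewrite zA ipE (le_trans (abs_sum _))//.
  under eq_bigr do rewrite absM abs_conj Av.
  rewrite -mulr_sumr -mulrA ler_wpM2l// -lpnorm1 lpnormE.
  rewrite (le_trans (lnorm_comparison n0 (lexx _) q1 _))// -lpnormE invr1 /c -mulrA.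
  rewrite ler_wpM2l ?powR_ge0//.
  apply: le_trans (opnorm_ub n0 A x p1' (ltW q1)) _.
  rewrite lpnormE; apply: (ler_wpM2l (opnorm_ge0 n0 m0 A p1' (ltW q1))).
  exact: (le_lnorm p1' (fun j => abs_ge0 (x j 0)) xt).
(* The upper bound is [key] at the constant family 1; the lower one comes from <z, v> = m lam = n
   tau^2, as [v] has entries of modulus 1. *)
have sumd : \sum_j d j = tau * c * m%:R `^ p^-1.
  apply/le_anti/andP; split.
    have := key (fun=> 1) (fun=> ler01); rewrite (lnorm_const m0)// mulr1.
    by under eq_bigr do rewrite mul1r.
  rewrite -mulrA -ntau mulrCA -expr2 -lamE -[leLHS]abs_iota_ge0; last first.
    by rewrite lamE mulr_ge0 ?sqr_ge0 ?ler0n.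
  rewrite -zv ipE (le_trans (abs_sum _))//; apply: ler_sum => j _.
  by rewrite absM abs_conj v1 mulr1.
have dlam j : d j = lam.
  have tc0 : 0 <= tau * c by rewrite mulr_ge0.
  rewrite (@lnorm_dual_eq _ _ m0 p (tau * c) d p1 tc0 d0 key sumd j) sumd /lam.
  by rewrite -[tau * c * _]mulrA -ntau mulrCA -expr2.
apply/eqP; rewrite -subr_eq0; apply/eqP/sqnorm_eq0/iota_inj.
rewrite -ipxx ipBl !ipBr !ipZl !ipZr zv vz !ipxx (sqnorm_flat v1) (sqnorm_flat dlam).
by rewrite -!rmorphM -!rmorphB expr1n mulr1/=; congr (iota _); ring.
Qed.

(* If x maximizes ||A y||^2 on the unit sphere, with value M, then
   Q(y) = M ||y||^2 - ||A y||^2 is nonnegative and vanishes at x; moving from x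
   by - t z, where z = M x - A^*A x, changes Q to first order by - 2 t ||z||^2. *)
Lemma max_eigenpair : exists (x : 'cV[F]_m) (M : R),
  eigenpair AA x (iota M) /\ forall y, sqnorm (A *m y) <= M * sqnorm y.
Proof.
have sqc k (B : 'M[F]_(k, m)) : continuous (fun u => sqnorm (B *m of_coords u)).
  apply: (@continuous_sumr _ _ _
    (fun i u => absF ((B *m of_coords u) i 0) ^+ 2)) => i u.
  under eq_fun do rewrite expr2.
  exact: (cvgM (@continuous_abs_mulmx m k B i u) (@continuous_abs_mulmx m k B i u)).
pose K : set 'cV[F]_m := [set x | sqnorm x = 1].
have Kcl : closed (@of_coords m @^-1` K).
  have -> : @of_coords m @^-1` K =
      (fun u => sqnorm (1%:M *m @of_coords m u)) @^-1` [set a | a = 1].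
    by apply/seteqP; split=> u; rewrite /K /= mul1mx.
  apply: preimage_closed; last exact: closed_eq.
  by move=> u _; exact: sqc.
have normalize y : y != 0 -> K (iota (Num.sqrt (sqnorm y))^-1 *: y).
  move=> y0; have s0 : 0 < sqnorm y.
    rewrite lt_def sqnorm_ge0 andbT; apply: contra y0 => /eqP s0.
    by rewrite (sqnorm_eq0 s0).
  rewrite /K /= sqnormZ abs_iota_ge0 ?invr_ge0 ?sqrtr_ge0//.
  by rewrite exprVn sqr_sqrtr ?(ltW s0)// mulVf// gt_eqF.
have Kne : K !=set0.
  by eexists; apply: normalize; exact: (const_mx1_neq0 m0).
have K1 x : K x -> forall j, absF (x j 0) <= 1.
  move=> Kx j; rewrite -(@expr_le1 _ 2)// -[leRHS]Kx /sqnorm (bigD1 j)//= lerDl.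
  by rewrite sumr_ge0// => i _; rewrite sqr_ge0.
have [x Kx xmax] := @maximum_attained m (fun x => sqnorm (A *m x)) K (sqc n A) Kcl Kne K1.
set M := sqnorm (A *m x) in xmax.
have bound y : sqnorm (A *m y) <= M * sqnorm y.
  have [->|y0] := eqVneq y 0.
    by rewrite mulmx0 -(scale0r 0) sqnormZ -[X in M * sqnorm X](scale0r 0)
      sqnormZ abs0 expr0n !mul0r mulr0.
  have := xmax _ (normalize _ y0); have := normalize _ y0.
  rewrite /K /= -scalemxAr !sqnormZ; set c := absF _ ^+ 2 => e.
  have c0 : 0 < c.
    rewrite lt_def sqr_ge0 andbT; apply/eqP => c0.
    by move/eqP: e; rewrite c0 mul0r eq_sym oner_eq0.
  move=> h; rewrite -(ler_pM2l c0) (le_trans h)//.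
  by rewrite mulrCA e mulr1.
have x0 : x != 0.
  apply/eqP => x0; move: Kx; rewrite /K /= x0 -(scale0r 0) sqnormZ abs0 expr0n mul0r.
  by move=> /eqP; rewrite eq_sym oner_eq0.
(* [B] is the self-adjoint operator whose quadratic form is [Q], so [Q] along a real step expands as
   a real quadratic polynomial. *)
pose B y := iota M *: y - AA *m y.
pose Q y := M * sqnorm y - sqnorm (A *m y).
have Q0 y : 0 <= Q y by rewrite subr_ge0.
have ipB y : ip y (B y) = iota (Q y).
  by rewrite ipBr ipZr ipxx -mulmxA -ip_mulmxl ipxx -rmorphM -rmorphB.
have BC y (w : 'cV[F]_m) : ip (B y) w = ip y (B w).
  by rewrite ipBr ipBl ipZl ipZr -!mulmxA ip_mulmxr ip_mulmxl.
have BB y (w : 'cV[F]_m) a : B (y - iota a *: w) = B y - iota a *: B w.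
  rewrite /B mulmxBr -scalemxAr !scalerBr scalerA [iota M * _]mulrC -scalerA.
  by rewrite !opprB [LHS]addrACA [RHS]addrACA; congr (_ + _); exact: addrC.
have expand (y w y' w' : 'cV[F]_m) a : ip (y - iota a *: w) (y' - iota a *: w') =
    ip y y' - iota a * ip y w' - iota a * (ip w y' - iota a * ip w w').
  by rewrite ipBl !ipBr !ipZl !ipZr mulrBr.
(* This step length gives t Q(z) < ||z||^2 when z is nonzero, so the second-order term cannot
   compensate the decrease; the added 1 avoids a zero denominator. *)
set z := B x; pose t := sqnorm z / (Q z + 1).
have Qt : Q (x - iota t *: z) = t ^+ 2 * Q z - t * sqnorm z *+ 2.
  apply: iota_inj; rewrite -ipB.
  rewrite BB -/z.
  have xz : ip x z = iota (Q x) := ipB x.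
  have xBz : ip x (B z) = iota (sqnorm z) by rewrite -BC ipxx.
  rewrite expand xz xBz ipxx ipB.
  have -> : Q x = 0 by rewrite /Q Kx mulr1 subrr.
  by rewrite -!rmorphM -!rmorphB -rmorphM -rmorphB/=; congr (iota _); ring.
exists x, M; split=> //; split=> //.
apply/eqP; rewrite eq_sym -subr_eq0 -/(B x) -/z; apply/eqP/sqnorm_eq0.
apply/eqP/contraT => sz0; have s0 : 0 < sqnorm z by rewrite lt_def sz0 sqnorm_ge0.
have Qz1 : 0 < Q z + 1 by rewrite ltr_wpDl.
have t0 : 0 < t by rewrite divr_gt0.
have tQ : t * Q z < sqnorm z.
  by rewrite /t mulrAC ltr_pdivrMr// ltr_pM2l// ltrDl.
have := Q0 (x - iota t *: z); rewrite Qt -mulrnAr expr2 -mulrA -mulrBr pmulr_rge0//.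
by move: s0 tQ; set s := sqnorm z => s0 tQ; rewrite mulr2n; lra.
Qed.

End FlatVectors.

(** * Both equivalences over the common scalar field *)

Lemma theorem6_scalars : theorem6_prop absF conj.
Proof.
move=> n m n0 m0 A.
have nR0 : 0 < n%:R :> R by rewrite ltr0n.
have mR0 : 0 < m%:R :> R by rewrite ltr0n.
have main p q : 1 <= p -> (1%:E < q)%E ->
    E_inf1 absF p q A <->
    exists v : 'cV[F]_m,
      [/\ eigenvector (adjmx conj A *m A) v,
          (forall j, absF (v j 0) = 1) &
          exists tau : R,
            (forall i, absF ((A *m v) i 0) = tau) /\
            tau = m%:R `^ p^-1 * n%:R `^ (- inv_exp q) * opnorm absF p%:E q A].
  move=> p1 q1; split; last first.
    by move=> [v [_ v1 [tau [Av tauE]]]]; exact: E_inf1_flat v1 Av tauE.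
  have p1' : (1 <= p%:E)%E by rewrite lee_fin.
  move=> E; have := opnorm_ge0 n0 m0 A p1' (ltW q1).
  rewrite le_eqVlt => /predU1P[N0|N0]; last first.
    have [v [v1 Av]] := E_inf1_flat_vector n0 m0 p1 q1 E N0.
    exists v; split=> //; last by eexists; split; first exact: Av.
    eexists; apply: (E_inf1_eigenpair n0 m0 p1 q1 v1 Av) => //.
    by rewrite !mulr_ge0 ?powR_ge0// ltW.
  (* If the norm is 0, then [A] vanishes and the all-ones vector works, with eigenvalue and [tau]
     both 0. *)
  have A0 (x : 'cV[F]_m) : A *m x = 0.
    apply/eqP; apply: contraT => /(lpnorm_gt0 (ltW q1)).
    rewrite ltNge (le_trans (opnorm_ub n0 A x p1' (ltW q1)))//.
    by rewrite -N0 mul0r.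
  exists (const_mx 1); split=> [|j|].
  - exists 0; split; first exact: const_mx1_neq0.
    by rewrite -mulmxA A0 mulmx0 scale0r.
  - by rewrite mxE abs1.
  - by exists 0; split=> [i|]; rewrite ?A0 ?mxE ?abs0// -N0 mulr0.
split=> //; set N := opnorm absF 2%:E 2%:E A.
have two1 : (1 <= 2%:E :> \bar R)%E by rewrite lee_fin ler1n.
have sqr_half k : (0 < k)%N -> (k%:R `^ 2^-1) ^+ 2 = k%:R :> R.
  by move=> k0; rewrite powR12_sqrt ?ler0n// sqr_sqrtr ?ler0n.
have two_lt : (1%:E < 2%:E :> \bar R)%E by rewrite lte_fin ltr1n.
rewrite main ?ler1n//; split.
  move=> [v [[lam vlam] v1 [tau [Av]]]]; rewrite -/N [inv_exp _]/= powRN => tauE.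
  exists v, lam; split=> //; first by exists tau.
  move=> mu w wmu.
  have w0 : 0 < lpnorm absF 2%:E w by apply: lpnorm_gt0 => //; exact: wmu.1.
  have s0 : 0 < sqnorm w by rewrite /sqnorm -lpnorm2_sqr exprn_gt0.
  (* Pairing with [v] gives m lam = n tau^2, and tau^2 = m N^2 / n. *)
  have lamE : lam = iota (N ^+ 2).
    have := eigenpair_sqnorm vlam; rewrite (sqnorm_flat Av) (sqnorm_flat v1).
    rewrite expr1n mulr1 => e.
    have mi : iota m%:R != 0 by rewrite -(rmorph0 iota) (inj_eq iota_inj) gt_eqF.
    apply: (mulIf mi); rewrite -e -rmorphM; congr (iota _).
    rewrite tauE !exprMn exprVn !sqr_half//.
    by field; rewrite gt_eqF.
  have si : 0 < iota (sqnorm w).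
    by rewrite lt_def iota_ge0 (ltW s0) andbT -(rmorph0 iota) (inj_eq iota_inj) gt_eqF.
  (* The order of [F] may be partial; multiplying by ||w||^2 turns both sides into images of real
     numbers. *)
  rewrite -(ler_pM2r si) -(eigenpair_sqnorm wmu) lamE -rmorphM iota_le.
  rewrite /sqnorm -!lpnorm2_sqr -exprMn ler_sqr ?nnegrE ?lpnorm_ge0//.
    exact: opnorm_ub.
  by rewrite mulr_ge0 ?lpnorm_ge0// opnorm_ge0.
move=> [v [lam [vlam v1 [tau Av] lam_max]]].
have tau0 : 0 <= tau by rewrite -(Av (Ordinal n0)) abs_ge0.
exists v; split=> //; first by exists lam.
exists tau; split=> //; rewrite -/N [inv_exp _]/= powRN.
set rn := n%:R `^ 2^-1; set rm := m%:R `^ 2^-1.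
have rn0 : 0 < rn by rewrite powR_gt0.
have rm0 : 0 < rm by rewrite powR_gt0.
suff -> : N = tau * rn / rm by field; rewrite !gt_eqF.
apply/le_anti/andP; split; last first.
  rewrite ler_pdivrMr// mulrC.
  have := opnorm_ub n0 A v two1 two1.
  by rewrite (lpnorm_flat n0 two1 Av) (lpnorm_flat m0 two1 v1) mulr1.
(* The upper bound on [N] uses that [M] is an eigenvalue bounding ||Ay||^2 / ||y||^2, hence M <= lam
   = n tau^2 / m by maximality of [lam]. *)
have [x [M [xM bound]]] := max_eigenpair m0 A.
have := lam_max _ _ xM => Mlam.
have Ml : M * m%:R <= n%:R * tau ^+ 2.
  rewrite -iota_le rmorphM -(sqnorm_flat Av) (eigenpair_sqnorm vlam).
  by rewrite (sqnorm_flat v1) expr1n mulr1 ler_wpM2r// iota_ge0 ler0n.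
have c0 : 0 <= tau * rn / rm.
  by rewrite divr_ge0 ?mulr_ge0 ?(ltW rn0) ?(ltW rm0).
apply: opnorm_le => // y _.
rewrite -ler_sqr ?nnegrE ?lpnorm_ge0 ?(mulr_ge0 c0) ?lpnorm_ge0//.
rewrite exprMn !lpnorm2_sqr (le_trans (bound y))// ler_wpM2r ?sqnorm_ge0//.
rewrite !exprMn exprVn !sqr_half// ler_pdivlMr//.
by rewrite [_ * n%:R]mulrC.
Qed.

End InnerProduct.
End ScalarField.

(** * The real and complex instances *)

Lemma theorem6_real_holds (R : realType) : theorem6_real R.
Proof.
apply: (@theorem6_scalars R R (fun x : R => `|x|) idfun 0 _ _ _ _ idfun) => //.
- by rewrite normr0 ler01.
- by move=> z; exists z, 0; split; rewrite ?normr0 ?normr_ge0 ?mul0r ?addr0.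
- by move=> z /=; rewrite -expr2 real_normK ?num_real.
Qed.

Lemma theorem6_complex_holds (R : realType) : theorem6_complex R.
Proof.
apply: (@theorem6_scalars R R[i] (@ComplexField.Normc.normc R) (real_complex R)
  (0 +i* 1)%C _ _ _ _ conjc).
- by [].
- exact: lecR.
- by rewrite /= expr0n expr1n add0r sqrtr1.
- move=> [a b]; exists a, b; split.
  + by rewrite /= -sqrtr_sqr ler_wsqrtr// lerDl sqr_ge0.
  + by rewrite /= -sqrtr_sqr ler_wsqrtr// lerDr sqr_ge0.
  + by apply/eqP; rewrite eq_complex /=; apply/andP; split; apply/eqP; ring.
- by move=> z; rewrite mulrC -sqr_normc rmorphXn.
- exact: conjc_real.
- exact: conjcK.
Qed.

Theorem theorem6 (R : realType) : theorem6_real R /\ theorem6_complex R.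
Proof. by split; [exact: theorem6_real_holds | exact: theorem6_complex_holds]. Qed.
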